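(* Consider the linear stochastic power system described in the context on a complete graph with $n\ge 2$ nodes. Suppose $\mathbf M=\eta\mathbf I_n$ and $\mathbf D=d\mathbf I_n$ with $\eta,d>0$, and that all line weights are equal: $w_{i,j}=\gamma>0$ for all $(i,j)\in\mathcal E$. Then the asymptotic variance of the frequency at node $i$, $i=1,\dots,n$, is $$q_{\omega_{i,i}}=\Big[\frac{1}{2d\eta}-\frac{\gamma(n-1)}{dn(2d^2+\gamma\eta n)}\Big]b_i^2+\frac{\gamma}{dn(2d^2+\gamma\eta n)}\big(\operatorname{tr}(\widetilde{\mathbf B}^2)-b_i^2\big),$$ and the asymptotic variance matrix of the phase angle differences is $$\mathbf Q_\delta=\frac{1}{2d\gamma n}\widetilde{\mathbf C}^\top\widetilde{\mathbf B}^2\widetilde{\mathbf C}.$$ In particular, for the line $e_k$ connecting nodes $i$ and $j$, $$q_{\delta_{k,k}}=\frac{1}{2d\gamma n}(b_i^2+b_j^2),$$ and $$\operatorname{tr}(\mathbf Q_\delta)=\frac{n-1}{2d\gamma n}\operatorname{tr}(\widetilde{\mathbf B}^2).$$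
   Context: Let $\mathcal G=(\mathcal V,\mathcal E)$ be a connected undirected graph with nodes $\mathcal V=\{1,\dots,n\}$ and lines $e_1,\dots,e_m$, with line weights $w_{i,j}=w_{j,i}>0$ for $(i,j)\in\mathcal E$ and $w_{i,j}=0$ otherwise (in the application $w_{i,j}=K_{i,j}\cos(\delta_i^*-\delta_j^* )$). A graph is complete if each pair of distinct nodes is connected by a line. $\mathbf L$ is the weighted Laplacian: $l_{i,j}=-w_{i,j}$ for $i\ne j$, $l_{i,i}=\sum_{k\neq i}w_{i,k}$. $\widetilde{\mathbf C}=(c_{i,k})\in\mathbb R^{n\times m}$ is the incidence matrix: $c_{i,k}=1$ if node $i$ is the beginning of $e_k$, $-1$ if it is the end, $0$ otherwise (for the complete graph, lines $(i,j)$ with $i<j$ are ordered lexicographically and begin at $i$). $\mathbf M=\mathrm{diag}(m_i)$, $m_i>0$; $\mathbf D=\mathrm{diag}(d_i)$, $d_i>0$; $\widetilde{\mathbf B}=\mathrm{diag}(b_i)$, $b_i>0$. The stochastic system is $$\mathrm d\boldsymbol\delta=\boldsymbol\omega\,\mathrm dt,\qquad \mathrm d\boldsymbol\omega=-\mathbf M^{-1}(\mathbf L\boldsymbol\delta+\mathbf D\boldsymbol\omega)\,\mathrm dt+\mathbf M^{-1}\widetilde{\mathbf B}\,\mathrm d\mathbf v(t),$$ with $\mathbf v$ a standard $n$-dimensional Brownian motion, and output $\mathbf y=(\widetilde{\mathbf C}^\top\boldsymbol\delta,\boldsymbol\omega)\in\mathbb R^{m+n}$. Let $\mathbf U=[\mathbf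 u_1\cdots\mathbf u_n]$ be orthogonal with $\mathbf U^\top\mathbf M^{-1/2}\mathbf L\mathbf M^{-1/2}\mathbf U=\mathrm{diag}(\lambda_1,\dots,\lambda_n)$, $0=\lambda_1<\lambda_2\le\cdots\le\lambda_n$; $\widehat{\mathbf U}=[\mathbf u_2\cdots\mathbf u_n]$, $\mathbf\Lambda_{n-1}=\mathrm{diag}(\lambda_2,\dots,\lambda_n)$. Define $$\mathbf A_2=\begin{bmatrix}\mathbf 0&\mathbf A_{22}\\ \mathbf A_{23}&-\mathbf U^\top\mathbf M^{-1}\mathbf D\mathbf U\end{bmatrix},\quad \mathbf A_{22}=[\mathbf 0\ \ \mathbf I_{n-1}]\in\mathbb R^{(n-1)\times n},\quad \mathbf A_{23}^\top=[\mathbf 0\ \ -\mathbf\Lambda_{n-1}]\in\mathbb R^{(n-1)\times n},$$ $$\mathbf B_2=\begin{bmatrix}\mathbf 0\\ \mathbf U^\top\mathbf M^{-1/2}\widetilde{\mathbf B}\end{bmatrix}\in\mathbb R^{(2n-1)\times n},\qquad \mathbf C_2=\begin{bmatrix}\widetilde{\mathbf C}^\top\mathbf M^{-1/2}\widehat{\mathbf U}&\mathbf 0\\ \mathbf 0&\mathbf M^{-1/2}\mathbf U\end{bmatrix}\in\mathbb R^{(m+n)\times(2n-1)}.$$ With $\mathbf Q_x$ the unique solution of $\mathbf A_2\mathbf Q_x+\mathbf Q_x\mathbf A_2^\top+\mathbf B_2\mathbf B_2^\top=\mathbf 0$, the asymptotic variance of the output ($\lim_{t\to\infty}\mathrm{Cov}(\mathbf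 y(t))$, the variance in the invariant distribution) is $\mathbf Q_y=\mathbf C_2\mathbf Q_x\mathbf C_2^\top$ (may be taken as definition). $\mathbf Q_\delta=(q_{\delta_{k,q}})$ is its upper left $m\times m$ block (asymptotic covariance of $\widetilde{\mathbf C}^\top\boldsymbol\delta$) and $\mathbf Q_\omega=(q_{\omega_{i,j}})$ its lower right $n\times n$ block (asymptotic covariance of $\boldsymbol\omega$). *)

(* Defs.v *)
From mathcomp Require Export all_boot all_order all_algebra.
Set Implicit Arguments.
Unset Strict Implicit.
Unset Printing Implicit Defensive.
Import Order.TTheory GRing.Theory Num.Theory.
Local Open Scope ring_scope.

Record power_system (R : rcfType) (n : nat) := PowerSystem {
  edge : rel 'I_n;
  weight : 'I_n -> 'I_n -> R;
  inertia : 'rV[R]_n;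
  damping : 'rV[R]_n;
  disturbance : 'rV[R]_n;
  edge_sym : symmetric edge;
  edge_irr : irreflexive edge;
  edge_connected : forall i j, connect edge i j;
  weight_sym : forall i j, weight i j = weight j i;
  weight_gt0 : forall i j, edge i j -> 0 < weight i j;
  weight_eq0 : forall i j, ~~ edge i j -> weight i j = 0;
  inertia_gt0 : forall i, 0 < inertia 0 i;
  damping_gt0 : forall i, 0 < damping 0 i;
  disturbance_gt0 : forall i, 0 < disturbance 0 i
}.

Section Network.
Variables (R : rcfType) (n : nat) (S : power_system R n).

Definition complete_graph : Prop := forall i j : 'I_n, i != j -> edge S i j.

(* Each line is listed once, as (i, j) with i < j, in lexicographic order; it
   begins at i and ends at j. *)
Definition lines : seq ('I_n * 'I_n) :=
  [seq e : 'I_n * 'I_n <- [seq (i, j) | i <- enum 'I_n, j <- enum 'I_n]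
     | (e.1 < e.2)%N && edge S e.1 e.2].

Definition nlines : nat := size lines.

Definition line (k : 'I_nlines) : 'I_n * 'I_n := tnth (in_tuple lines) k.

Definition laplacian : 'M[R]_n :=
  \matrix_(i, j) if i == j then \sum_(k | k != i) weight S i k
                 else - weight S i j.

Definition incidence : 'M[R]_(n, nlines) :=
  \matrix_(i, k) if i == (line k).1 then 1
                 else if i == (line k).2 then -1 else 0.

Definition M_mx : 'M[R]_n := diag_mx (inertia S).
Definition D_mx : 'M[R]_n := diag_mx (damping S).
Definition B_mx : 'M[R]_n := diag_mx (disturbance S).

(* M^(-1/2) *)
Definition M_isqrt : 'M[R]_n :=
  diag_mx (\row_i (Num.sqrt (inertia S 0 i))^-1).

End Network.

(* From here on the number of nodes is p.+1, convertible to 1 + p; column 0 of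
   U is u_1 and rsubmx U is [u_2 ... u_n]. *)
Section Modes.
Variables (R : rcfType) (p : nat) (S : power_system R p.+1).
Variables (U : 'M[R]_(1 + p)) (lam : 'rV[R]_(1 + p)).

Definition modal_decomposition : Prop :=
  [/\ U^T *m U = 1%:M,
      U^T *m (M_isqrt S *m laplacian S *m M_isqrt S) *m U = diag_mx lam,
      lam 0 ord0 = 0,
      forall i : 'I_(1 + p), i != ord0 -> 0 < lam 0 i
    & forall i j : 'I_(1 + p), (i <= j)%N -> lam 0 i <= lam 0 j].

Definition A22 : 'M[R]_(p, 1 + p) := row_mx 0 1%:M.

Definition A23 : 'M[R]_(1 + p, p) := (row_mx 0 (- diag_mx (rsubmx lam)))^T.

Definition A2 : 'M[R]_(p + (1 + p)) :=
  block_mx 0 A22 A23 (- (U^T *m invmx (M_mx S) *m D_mx S *m U)).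

Definition B2 : 'M[R]_(p + (1 + p), 1 + p) :=
  col_mx 0 (U^T *m M_isqrt S *m B_mx S).

Definition C2 : 'M[R]_(nlines S + (1 + p), p + (1 + p)) :=
  block_mx ((incidence S)^T *m M_isqrt S *m rsubmx U) 0
           0 (M_isqrt S *m U).

Definition lyapunov (Qx : 'M[R]_(p + (1 + p))) : Prop :=
  A2 *m Qx + Qx *m A2^T + B2 *m B2^T = 0.

(* Asymptotic variance of the output (C^T delta, omega), where Qx is the
   solution of the Lyapunov equation. *)
Definition Qy (Qx : 'M[R]_(p + (1 + p))) : 'M[R]_(nlines S + (1 + p)) :=
  C2 *m Qx *m C2^T.

Definition Qdelta (Qx : 'M[R]_(p + (1 + p))) : 'M[R]_(nlines S) :=
  ulsubmx (Qy Qx).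

Definition Qomega (Qx : 'M[R]_(p + (1 + p))) : 'M[R]_(1 + p) :=
  drsubmx (Qy Qx).

End Modes.

(* Main.v *)
(* For equal weights, M^(-1/2) L M^(-1/2) = mu Pi, where mu = gamma n / eta and
   Pi = 1 - K, with K the averaging projector. Since Pi^2 = Pi,
   every lam_i is 0 or mu, so lam_2 = ... = lam_n = mu, and then V V^T = Pi and
   u_1 u_1^T = K for U = [u_1 V]. As damping and inertia are
   scalar and all nonzero eigenvalues agree, the Lyapunov equation splits along
   Pi and K into linear systems for single entries, and going back through U
   gives Qdelta and Qomega in terms of Pi, K and B^2. *)
Require Import Defs.
From mathcomp Require Import all_boot all_order all_algebra.
From mathcomp Require Import ring lra.
Set Implicit Arguments.
Unset Strict Implicit.
Unset Printing Implicit Defensive.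
Import Order.TTheory GRing.Theory Num.Theory.
Local Open Scope ring_scope.

(** * The Lyapunov equation in modal blocks *)

Section BlockLyapunov.
Variables (R : realFieldType) (p : nat) (a mu : R).
Hypotheses (a_gt0 : 0 < a) (mu_gt0 : 0 < mu).
Variables (h00 : 'M[R]_1) (h01 : 'M[R]_(1, p)) (h10 : 'M[R]_(p, 1))
  (h11 : 'M[R]_p).

(** The form of [A2] when the nonzero eigenvalues all equal [mu] and [M^-1 D] is [a] times the
    identity; the frequency block lists the kernel mode first. *)
Definition modal_drift : 'M[R]_(p + (1 + p)) :=
  block_mx 0 (row_mx 0 1%:M) (- mu *: col_mx 0 1%:M) (- a)%:M.

Definition modal_noise : 'M[R]_(p + (1 + p)) :=
  block_mx 0 0 0 (block_mx h00 h01 h10 h11).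

Definition modal_covariance : 'M[R]_(p + (1 + p)) :=
  block_mx ((2 * a * mu)^-1 *: h11)
           (row_mx ((mu + 2 * a ^+ 2)^-1 *: h10) 0)
           (col_mx ((mu + 2 * a ^+ 2)^-1 *: h01) 0)
           (block_mx ((2 * a)^-1 *: h00) ((a / (mu + 2 * a ^+ 2)) *: h01)
                     ((a / (mu + 2 * a ^+ 2)) *: h10) ((2 * a)^-1 *: h11)).

(* In these blocks the equation has scalar coefficients only, hence decouples
   into linear systems for the individual entries. *)
Lemma modal_lyapunovE (X : 'M[R]_p) y0 (Y1 : 'M[R]_p) w0 (W1 : 'M[R]_p)
    z00 z01 z10 (Z11 : 'M[R]_p) :
  let Q := block_mx X (row_mx y0 Y1) (col_mx w0 W1)
             (block_mx z00 z01 z10 Z11) in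
  modal_drift *m Q + Q *m modal_drift^T + modal_noise =
  block_mx (W1 + Y1)
    (row_mx (z10 - a *: y0) (Z11 - mu *: X - a *: Y1))
    (col_mx (z01 - a *: w0) (Z11 - mu *: X - a *: W1))
    (block_mx (h00 - (2 * a) *: z00) (h01 - mu *: w0 - (2 * a) *: z01)
      (h10 - mu *: y0 - (2 * a) *: z10)
      (h11 - mu *: (W1 + Y1) - (2 * a) *: Z11)).
Proof.
rewrite /= /modal_drift /modal_noise tr_block_mx !trmx0 tr_row_mx trmx0 trmx1.
rewrite linearZ /= tr_col_mx trmx0 trmx1 tr_scalar_mx !mulmx_block
  !add_block_mx.
rewrite !(mul0mx, mulmx0, add0r, addr0) -!scalemxAl -!scalemxAr.
rewrite !(mul_row_col, mul_row_block, mul_col_row, mul_block_col, mul_col_mx,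
  mul_mx_row).
rewrite !(mul0mx, mulmx0, mul1mx, mulmx1, add0r, addr0).
rewrite !mul_scalar_mx !mul_mx_scalar.
rewrite !(scale_row_mx, scale_col_mx, scale_block_mx, add_row_mx, add_col_mx,
  add_block_mx).
congr block_mx; first congr row_mx; last congr block_mx;
  try congr col_mx; apply/matrixP=> i j; rewrite !mxE; ring.
Qed.

(** Existence and uniqueness come together by solving the entrywise systems. The phase block forces
    [W1 + Y1 = 0], the two mixed blocks force [W1 = Y1], so both vanish; what remains is triangular,
    with pivots [2 * a], [mu] and [mu + 2 * a ^+ 2]. *)
Lemma modal_covarianceP Q :
  modal_drift *m Q + Q *m modal_drift^T + modal_noise = 0 <->
  Q = modal_covariance.
Proof.
have a0 : a != 0 by rewrite gt_eqF.
have mu0 : mu != 0 by rewrite gt_eqF.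
have s0 : mu + 2 * a ^+ 2 != 0.
  by rewrite gt_eqF // addr_gt0 ?mulr_gt0 ?exprn_gt0.
split=> [|->]; last first.
  apply/eqP; rewrite modal_lyapunovE !(block_mx_eq0, row_mx_eq0, col_mx_eq0).
  by do ?[apply/andP; split]; apply/eqP/matrixP=> i j; rewrite !mxE; field;
    rewrite ?a0 ?s0 ?mu0.
rewrite -[Q]submxK -[ursubmx Q]hsubmxK -[dlsubmx Q]vsubmxK -[drsubmx Q]submxK.
move: (ulsubmx Q) (lsubmx (ursubmx Q)) (rsubmx (ursubmx Q))
  (usubmx (dlsubmx Q)) (dsubmx (dlsubmx Q))
  (ulsubmx (drsubmx Q)) (ursubmx (drsubmx Q)) (dlsubmx (drsubmx Q))
  (drsubmx (drsubmx Q)) => X y0 Y1 w0 W1 z00 z01 z10 Z11.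
rewrite modal_lyapunovE => /eqP.
rewrite !(block_mx_eq0, row_mx_eq0, col_mx_eq0) => /and4P[/eqP/matrixP WY].
move=> /andP[/eqP/matrixP z10E /eqP/matrixP Z11E].
move=> /andP[/eqP/matrixP z01E /eqP/matrixP Z11E'].
move=> /and4P[/eqP/matrixP h00E /eqP/matrixP h01E].
move=> /eqP/matrixP h10E /eqP/matrixP h11E.
(* With [Y1 = - W1], the difference of the two mixed equations is [2 * a * W1 = 0]. *)
have W10 i j : W1 i j = 0.
  move: (WY i j) (Z11E i j) (Z11E' i j); rewrite !mxE => e0 e1 e2.
  have eY : Y1 i j = - W1 i j by lra.
  by rewrite eY in e1; apply: (mulfI a0); lra.
have Y10 i j : Y1 i j = 0.
  by move: (WY i j); rewrite !mxE W10 add0r.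
rewrite /modal_covariance; congr block_mx;
  [|congr row_mx|congr col_mx|congr block_mx]; apply/matrixP=> i j.
all: rewrite !mxE ?W10 ?Y10 //.
(* In each remaining block the noise entry is written as a multiple of one unknown, which leaves an
   identity of fractions. *)
- move: (Z11E i j) (h11E i j); rewrite !mxE W10 Y10 => e1 e2.
  have eZ : Z11 i j = mu * X i j by lra.
  have -> : h11 i j = 2 * a * mu * X i j by rewrite eZ in e2; lra.
  by field; rewrite a0 mu0.
- move: (z10E i j) (h10E i j); rewrite !mxE => e1 e2.
  have eZ : z10 i j = a * y0 i j by lra.
  have -> : h10 i j = (mu + 2 * a ^+ 2) * y0 i j by rewrite eZ in e2; lra.
  by field.
- move: (z01E i j) (h01E i j); rewrite !mxE => e1 e2.
  have eZ : z01 i j = a * w0 i j by lra.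
  have -> : h01 i j = (mu + 2 * a ^+ 2) * w0 i j by rewrite eZ in e2; lra.
  by field.
- move: (h00E i j); rewrite !mxE => e2.
  have -> : h00 i j = 2 * a * z00 i j by lra.
  by field.
- move: (z01E i j) (h01E i j); rewrite !mxE => e1 e2.
  have eZ : z01 i j = a * w0 i j by lra.
  have -> : h01 i j = (mu + 2 * a ^+ 2) * w0 i j by rewrite eZ in e2; lra.
  by rewrite eZ; field.
- move: (z10E i j) (h10E i j); rewrite !mxE => e1 e2.
  have eZ : z10 i j = a * y0 i j by lra.
  have -> : h10 i j = (mu + 2 * a ^+ 2) * y0 i j by rewrite eZ in e2; lra.
  by rewrite eZ; field.
- move: (h11E i j); rewrite !mxE W10 Y10 => e2.
  have -> : h11 i j = 2 * a * Z11 i j by lra.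
  by field.
Qed.

End BlockLyapunov.

(** * Eigenvalues and eigenvectors of a scaled projector *)

Section Spectrum.
Variables (R : fieldType) (p : nat).
Variables (U Pi : 'M[R]_(1 + p)) (lam : 'rV[R]_(1 + p)) (mu : R).
Hypotheses (orthoU : U^T *m U = 1%:M) (idemPi : Pi *m Pi = Pi).
Hypotheses (mu_neq0 : mu != 0) (diagPi : U^T *m (mu *: Pi) *m U = diag_mx lam).
Hypothesis lam0 : lam 0 ord0 = 0.
Hypothesis lam_neq0 : forall i : 'I_(1 + p), i != ord0 -> lam 0 i != 0.

(** The relation [T *m T = mu *: T] for [T = mu *: Pi] survives conjugation by [U], so each
    eigenvalue satisfies [l ^+ 2 = mu * l], and a nonzero one can be cancelled. *)
Lemma scaled_projector_eigenvalues : rsubmx lam = const_mx mu.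
Proof.
have lamE : diag_mx lam *m diag_mx lam = mu *: diag_mx lam.
  rewrite -diagPi; set T := mu *: Pi.
  have TT : T *m T = mu *: T by rewrite -scalemxAl -scalemxAr idemPi.
  rewrite -!mulmxA (mulmxA U) (mulmx1C orthoU) mul1mx (mulmxA T) TT.
  by rewrite -scalemxAl -scalemxAr.
apply/rowP=> i; rewrite !mxE.
have /lam_neq0 li : rshift 1 i != ord0 by rewrite -val_eqE.
move/matrixP/(_ (rshift 1 i) (rshift 1 i)): lamE.
by rewrite mul_diag_mx !mxE eqxx !mulr1n => /(mulIf li).
Qed.

(** Undoing the diagonalisation, [mu *: Pi] is [U] times diag(0, mu, ..., mu) times [U^T]; the zero
    removes the first column of [U]. *)
Lemma scaled_projector_modes : rsubmx U *m (rsubmx U)^T = Pi.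
Proof.
have diagE : diag_mx lam = block_mx 0 0 0 mu%:M.
  rewrite -[lam]hsubmxK diag_mx_row scaled_projector_eigenvalues diag_const_mx.
  by congr block_mx; apply/matrixP=> i j; rewrite !mxE !ord1 lshift0 lam0
    mul0rn.
apply: (scalerI mu_neq0).
have <- : U *m diag_mx lam *m U^T = mu *: Pi.
  by rewrite -diagPi !mulmxA (mulmx1C orthoU) mul1mx -mulmxA (mulmx1C orthoU)
    mulmx1.
rewrite diagE -[U in RHS]hsubmxK tr_row_mx mul_row_block mul_row_col.
by rewrite !(mulmx0, mul0mx, add0r) mul_mx_scalar -scalemxAl.
Qed.

Lemma scaled_projector_kernel_mode : lsubmx U *m (lsubmx U)^T = 1%:M - Pi.
Proof.
rewrite -(mulmx1C orthoU) -[U in RHS]hsubmxK tr_row_mx mul_row_col.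
by rewrite scaled_projector_modes addrK.
Qed.

End Spectrum.

(** * The averaging projector and diagonal entries of its products *)

Section Averaging.
Variables (R : numFieldType) (n : nat).

Definition averaging_mx : 'M[R]_n := const_mx n%:R^-1.

Lemma averaging_idem : averaging_mx *m averaging_mx = averaging_mx.
Proof.
apply/matrixP=> i j; rewrite !mxE.
under eq_bigr do rewrite !mxE.
rewrite sumr_const card_ord -[LHS]mulr_natr -mulrA mulVf ?mulr1 // pnatr_eq0.
(* The division is legitimate because the index [i] excludes [n = 0]. *)
by case: n i => // -[].
Qed.

Lemma deviation_idem :
  (1%:M - averaging_mx) *m (1%:M - averaging_mx) = 1%:M - averaging_mx.
Proof.
by rewrite mulmxBl mul1mx mulmxBr mulmx1 averaging_idem subrr subr0.
Qed.

Variable x : 'rV[R]_n.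

Lemma diag_mul_averaging_diag i :
  (diag_mx x *m averaging_mx) i i = x 0 i / n%:R.
Proof. by rewrite mul_diag_mx !mxE. Qed.

Lemma averaging_mul_diag_diag i :
  (averaging_mx *m diag_mx x) i i = x 0 i / n%:R.
Proof. by rewrite mul_mx_diag !mxE mulrC. Qed.

(** Averaging on both sides makes all entries equal; this is where the trace in the frequency
    variance comes from. *)
Lemma averaging_diag_averaging_diag i :
  (averaging_mx *m diag_mx x *m averaging_mx) i i = \tr (diag_mx x) / n%:R ^+ 2.
Proof.
rewrite mul_mx_diag !mxE mxtrace_diag mulr_suml; apply: eq_bigr => k _.
by rewrite !mxE mulrAC mulrC expr2 invfM.
Qed.

End Averaging.

(** Each index lies in exactly [n - 1] unordered pairs. *)
Lemma sum_lt_pairs (R : pzRingType) n (x : 'I_n -> R) :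
  \sum_(i < n) \sum_(j < n | (i < j)%N) (x i + x j) = (n%:R - 1) * \sum_i x i.
Proof.
under eq_bigr do rewrite big_split.
(* After the exchange, the term [x i] is counted for every [j > i] and for every [j < i], that is,
   for every [j] other than [i]. *)
rewrite big_split /= [X in _ + X](exchange_big_dep predT) //= -big_split
  mulr_sumr /=.
apply: eq_bigr => i _.
rewrite [X in X + _]big_mkcond [X in _ + X]big_mkcond -big_split /=.
rewrite (bigD1 i) //= ltnn addr0 add0r.
rewrite (eq_bigr (fun=> x i)) => [|j]; last first.
  by rewrite -val_eqE /=; case: ltngtP; rewrite ?addr0 ?add0r.
rewrite (sumr_const (predC1 i)) cardC1 card_ord mulrBl mul1r mulr_natl.
(* The cardinal [n.-1] is truncated, hence the case split; [n = 0] has no index. *)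
by case: n i x => [[]//|n] i x; rewrite mulrS addrAC subrr add0r.
Qed.

(** * The incidence matrix and the lines of a complete graph *)

Section Lines.
Variables (R : rcfType) (n : nat) (S : power_system R n).

Lemma line_lt (k : 'I_(nlines S)) : ((line k).1 < (line k).2)%N.
Proof.
have := mem_tnth k (in_tuple (lines S)).
by rewrite mem_filter => /andP[/andP[]].
Qed.

Lemma line_neq (k : 'I_(nlines S)) : (line k).1 != (line k).2.
Proof. by rewrite -val_eqE neq_ltn line_lt. Qed.

(** The ends of a line are distinct, so the nested conditional becomes a difference of indicators,
    which can be summed term by term. *)
Lemma incidenceE i (k : 'I_(nlines S)) :
  incidence S i k = (i == (line k).1)%:R - (i == (line k).2)%:R.
Proof.
rewrite mxE; have [->|_] := eqVneq i (line k).1.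
  by rewrite (negPf (line_neq k)) subr0.
by rewrite sub0r; case: eqP => _; rewrite ?oppr0.
Qed.

(** Every incidence column holds one [1] and one [-1]. Hence the transposed incidence matrix absorbs
    [Pi = 1 - K], and no projector is left in [Qdelta]. *)
Lemma incidence_averaging : (incidence S)^T *m averaging_mx R n = 0.
Proof.
apply/matrixP=> k j; rewrite !mxE.
under eq_bigr do rewrite mxE incidenceE mxE.
have sum_delta a : \sum_(i < n) (i == a)%:R = 1 :> R.
  by rewrite (bigD1 a) //= eqxx big1 ?addr0 // => i /negPf->.
by rewrite -mulr_suml sumrB !sum_delta subrr mul0r.
Qed.

Lemma incidence_diag_diag (x : 'rV[R]_n) (k : 'I_(nlines S)) :
  ((incidence S)^T *m diag_mx x *m incidence S) k k =
  x 0 (line k).1 + x 0 (line k).2.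
Proof.
rewrite mul_mx_diag mxE (bigD1 (line k).1) //=.
rewrite (bigD1 (line k).2) /=; last first.
  by rewrite eq_sym line_neq.
rewrite big1 => [|i /andP[/negPf i1 /negPf i2]].
  rewrite !mxE !eqxx ![_.2 == _.1]eq_sym (negPf (line_neq k)).
  by ring.
by rewrite mxE mxE incidenceE i1 i2 subrr !mul0r.
Qed.

Hypothesis completeS : complete_graph S.

Lemma complete_edge i j : edge S i j = (i != j).
Proof.
by have [->|/completeS->//] := eqVneq i j; rewrite edge_irr.
Qed.

(** On a complete graph the filter defining [lines] keeps all pairs with [i < j], so the pair count
    applies. *)
Lemma sum_complete_lines (x : 'I_n -> R) :
  \sum_(k < nlines S) (x (line k).1 + x (line k).2) = (n%:R - 1) * \sum_i x i.
Proof.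
rewrite -(big_tnth _ _ (lines S) predT (fun e => x e.1 + x e.2)).
rewrite big_filter big_mkcond big_allpairs.
rewrite big_enum /=.
under eq_bigr => i _ do rewrite big_enum -big_mkcond /=.
rewrite -sum_lt_pairs; apply: eq_bigr => i _; apply: eq_bigl => j.
by rewrite complete_edge -val_eqE /=; case: ltngtP.
Qed.

End Lines.

Lemma M_isqrt_scalar (R : rcfType) n (S : power_system R n) eta :
  M_mx S = eta%:M -> M_isqrt S = (Num.sqrt eta)^-1%:M.
Proof.
move=> /matrixP ME; rewrite /M_isqrt -diag_const_mx; congr diag_mx.
by apply/rowP=> i; move: (ME i i); rewrite !mxE eqxx !mulr1n => ->.
Qed.

Lemma uniform_laplacian (R : rcfType) n (S : power_system R n) gamma :
  complete_graph S -> (forall i j, edge S i j -> weight S i j = gamma) ->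
  laplacian S = (gamma * n%:R) *: (1%:M - averaging_mx R n).
Proof.
move=> completeS wS; apply/matrixP=> i j; rewrite !mxE.
have n0 : n%:R != 0 :> R.
  by rewrite pnatr_eq0; case: n i {S j completeS wS} => // -[].
have [_|ij] /= := eqVneq i j.
  rewrite (eq_bigr (fun=> gamma)) => [|k ki]; last first.
    by apply: wS; rewrite complete_edge // eq_sym.
  rewrite (sumr_const (predC1 i)) cardC1 card_ord.
  rewrite -[LHS]mulr_natr -subn1 natrB ?lt0n -?(pnatr_eq0 R) //.
  by field.
by rewrite wS ?complete_edge //; field.
Qed.

(** * The uniform complete network: from modal blocks back to the outputs *)

Section UniformNetwork.
Variables (R : rcfType) (p : nat) (S : power_system R p.+1).
Variables (U : 'M[R]_(1 + p)) (lam : 'rV[R]_(1 + p)) (eta d gamma : R).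
Hypotheses (completeS : complete_graph S)
  (modalS : modal_decomposition S U lam).
Hypotheses (eta_gt0 : 0 < eta) (d_gt0 : 0 < d) (gamma_gt0 : 0 < gamma).
Hypotheses (MS : M_mx S = eta%:M) (DS : D_mx S = d%:M).
Hypothesis weightS : forall i j, edge S i j -> weight S i j = gamma.

Let n : R := p.+1%:R.
Let K : 'M[R]_(1 + p) := averaging_mx R p.+1.
Let B : 'M[R]_(1 + p) := B_mx S *m B_mx S.
Let u := lsubmx U.
Let V := rsubmx U.
(** The matrices [M^-1 D] and [M^(-1/2)] are the scalars [a] and [s]; [mu] is the common nonzero
    eigenvalue. *)
Let a := d / eta.
Let mu := gamma * n / eta.
Let s := (Num.sqrt eta)^-1.

Let n_gt0 : 0 < n. Proof. by rewrite ltr0Sn. Qed.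
Let n_neq0 : n != 0. Proof. by rewrite gt_eqF. Qed.
Let eta_neq0 : eta != 0. Proof. by rewrite gt_eqF. Qed.
Let d_neq0 : d != 0. Proof. by rewrite gt_eqF. Qed.
Let gamma_neq0 : gamma != 0. Proof. by rewrite gt_eqF. Qed.
Let mu_gt0 : 0 < mu. Proof. by rewrite divr_gt0 ?mulr_gt0. Qed.
Let mu_neq0 : mu != 0. Proof. by rewrite gt_eqF. Qed.
Let sE : s * s = eta^-1. Proof. by rewrite -invfM -expr2 sqr_sqrtr // ltW. Qed.

Let orthoU : U^T *m U = 1%:M. Proof. by case: modalS. Qed.

Let diagU : U^T *m (mu *: (1%:M - K)) *m U = diag_mx lam.
Proof.
case: modalS => _ <- _ _ _; congr (_ *m _ *m _).
rewrite (M_isqrt_scalar MS) (uniform_laplacian completeS weightS).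
by rewrite mul_scalar_mx mul_mx_scalar !scalerA mulrCA mulrA -[_^-1 * _]/(s * s)
  sE /mu mulrC.
Qed.

Let lam0 : lam 0 ord0 = 0. Proof. by case: modalS. Qed.
Let lam_neq0 (i : 'I_(1 + p)) : i != ord0 -> lam 0 i != 0.
Proof. by case: modalS => _ _ _ h _ /h; move/gt_eqF->. Qed.

Let idemPi : (1%:M - K) *m (1%:M - K) = 1%:M - K := deviation_idem R p.+1.

(** Repeated eigenvalues leave [V] free up to an orthogonal change of basis; the outputs see [U]
    only through [u *m u^T] and [V *m V^T], which are determined. *)
Let uuT : u *m u^T = K.
Proof.
by rewrite (scaled_projector_kernel_mode orthoU idemPi mu_neq0 diagU) // opprB
  addrCA subrr addr0.
Qed.

Let VVT : V *m V^T = 1%:M - K.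
Proof. exact: (scaled_projector_modes orthoU idemPi mu_neq0 diagU). Qed.

Definition uniform_covariance := modal_covariance a mu
  (eta^-1 *: (u^T *m B *m u)) (eta^-1 *: (u^T *m B *m V))
  (eta^-1 *: (V^T *m B *m u)) (eta^-1 *: (V^T *m B *m V)).

(** Both [A2] and [B2 *m B2^T] have the modal shape, the noise blocks being those of [U^T *m B *m U]
    divided by [eta]. *)
Lemma uniform_lyapunovP Qx : lyapunov S U lam Qx <-> Qx = uniform_covariance.
Proof.
rewrite -modal_covarianceP // ?divr_gt0 // /lyapunov.
have -> : A2 S U lam = modal_drift p a mu.
  rewrite /A2 /modal_drift /A22 /A23; congr block_mx.
    rewrite (scaled_projector_eigenvalues orthoU idemPi diagU) //.
    rewrite diag_const_mx tr_row_mx trmx0 linearN /= tr_scalar_mx.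
    by rewrite scale_col_mx scaler0 scale_scalar_mx mulr1 -raddfN.
  rewrite MS DS invmx_scalar mul_mx_scalar mul_mx_scalar -!scalemxAl orthoU.
  by rewrite scalerA scale_scalar_mx mulr1 raddfN.
have -> // : B2 S U *m (B2 S U)^T = modal_noise
  (eta^-1 *: (u^T *m B *m u)) (eta^-1 *: (u^T *m B *m V))
  (eta^-1 *: (V^T *m B *m u)) (eta^-1 *: (V^T *m B *m V)).
rewrite /B2 /modal_noise tr_col_mx trmx0 mul_col_row !mul0mx mulmx0.
congr block_mx.
rewrite (M_isqrt_scalar MS) mul_mx_scalar -!scalemxAl linearZ /= -scalemxAr
  scalerA sE.
rewrite trmx_mul trmxK tr_diag_mx mulmxA -(mulmxA U^T) -/B -scale_block_mx.
congr (_ *: _).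
by rewrite -[U]hsubmxK tr_row_mx mul_col_mx mul_col_row.
Qed.

Lemma uniform_Qdelta : Qdelta S U uniform_covariance =
  (2 * d * gamma * n)^-1 *: ((incidence S)^T *m B *m incidence S).
Proof.
have CV : (incidence S)^T *m V *m V^T = (incidence S)^T.
  by rewrite -mulmxA VVT mulmxBr mulmx1 incidence_averaging subr0.
have VC : V *m (V^T *m incidence S) = incidence S.
  by rewrite -[RHS]trmxK -CV !trmx_mul !trmxK.
rewrite /Qdelta /Qy /C2 /uniform_covariance /modal_covariance tr_block_mx !trmx0
  !mulmx_block block_mxKul.
rewrite !(mul0mx, mulmx0, addr0).
rewrite (M_isqrt_scalar MS) mul_mx_scalar -!scalemxAl [(_ *: _)^T]linearZ /=
  -!scalemxAr -!scalemxAl !scalerA.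
rewrite trmx_mul trmxK -/V !mulmxA CV -!mulmxA VC; congr (_ *: _).
(* The factor [eta^-2], half from [s * s] and half from the noise, cancels against
   [a * mu = d * gamma * n / eta^2]. *)
by rewrite !mulrA -/s sE /a /mu; move: (n) n_neq0 => N N0; field;
  rewrite gamma_neq0 d_neq0 eta_neq0 N0.
Qed.

(** The diagonal modal blocks carry the factor [1 / (2 * a)] and the cross blocks
    [a / (mu + 2 * a ^+ 2)]; conjugation by [U] turns them into products with [K] and [1 - K]. *)
Lemma uniform_Qomega : Qomega S U uniform_covariance =
  (2 * d * eta)^-1 *: (K *m B *m K + (1%:M - K) *m B *m (1%:M - K))
  + (d / (eta * (2 * d ^+ 2 + gamma * eta * n))) *:
    (K *m B *m (1%:M - K) + (1%:M - K) *m B *m K).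
Proof.
rewrite /Qomega /Qy /C2 /uniform_covariance /modal_covariance tr_block_mx !trmx0
  !mulmx_block block_mxKdr.
rewrite !(mul0mx, mulmx0, add0r).
rewrite (M_isqrt_scalar MS) mul_scalar_mx [(_ *: _)^T]linearZ /= -!scalemxAr
  -!scalemxAl !scalerA.
rewrite -{1 2}[U]hsubmxK tr_row_mx -/u -/V mul_row_block mul_row_col.
rewrite -VVT -uuT.
have e1 : eta^-1 * ((2 * a)^-1 / eta) = (2 * d * eta)^-1.
  by rewrite /a; field; rewrite d_neq0 eta_neq0.
have e2 : eta^-1 * (a / (mu + 2 * a ^+ 2) / eta)
    = d / (eta * (2 * d ^+ 2 + gamma * eta * n)).
  rewrite /a /mu; move: (n) n_gt0 => N N_gt0.
  have s_neq0 : 2 * d ^+ 2 + gamma * eta * N != 0.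
    by rewrite gt_eqF // addr_gt0 ?mulr_gt0 ?exprn_gt0.
  by field; rewrite eta_neq0 s_neq0.
rewrite -!scalemxAr !mulmxDl -!scalemxAl !mulmxA -/s sE !scalerDr !scalerA.
rewrite e1 e2.
by rewrite [X in _ + X]addrC addrACA [X in _ + X]addrC.
Qed.

(** With [X = K B + B K - 2 K B K], the two bracketed sums of [uniform_Qomega] are [B - X] and [X],
    and the diagonal of [X] is explicit in [b_i^2] and the trace. *)
Lemma uniform_Qomega_diag i : Qomega S U uniform_covariance i i =
  ((2 * d * eta)^-1
    - gamma * (n - 1) / (d * n * (2 * d ^+ 2 + gamma * eta * n)))
    * disturbance S 0 i ^+ 2
  + gamma / (d * n * (2 * d ^+ 2 + gamma * eta * n))
    * (\tr B - disturbance S 0 i ^+ 2).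
Proof.
rewrite uniform_Qomega.
have -> : B = diag_mx (\row_j disturbance S 0 j ^+ 2).
  by rewrite /B /B_mx mulmx_diag; congr diag_mx.
set x := \row_j _; pose D : 'M[R]_(1 + p) := diag_mx x.
have xi : x 0 i = disturbance S 0 i ^+ 2 by rewrite mxE.
have DKE : (D *m K) i i = x 0 i / n := diag_mul_averaging_diag x i.
have KDE : (K *m D) i i = x 0 i / n := averaging_mul_diag_diag x i.
have KDKE : (K *m D *m K) i i = \tr D / n ^+ 2 :=
  averaging_diag_averaging_diag x i.
rewrite -/D !(mulmxBl, mulmxBr, mul1mx, mulmx1).
(* The products become opaque so that [mxE] does not unfold them into sums. *)
move: (K *m D) (D *m K) (K *m D *m K) DKE KDE KDKE => KD DK KDK DKE KDE KDKE.
rewrite !mxE DKE KDE KDKE xi eqxx mulr1n.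
move: (n) n_gt0 n_neq0 (\tr D) (disturbance S 0 i) => N N_gt0 N_neq0 t b.
have s_neq0 : 2 * d ^+ 2 + gamma * eta * N != 0.
  by rewrite gt_eqF // addr_gt0 ?mulr_gt0 ?exprn_gt0.
by field; rewrite eta_neq0 s_neq0 N_neq0 d_neq0.
Qed.

End UniformNetwork.

Theorem proposition4p6 (R : rcfType) (p : nat)
    (S : power_system R p.+1) (U : 'M[R]_p.+1) (lam : 'rV[R]_p.+1)
    (eta d gamma : R) :
  (2 <= p.+1)%N ->
  complete_graph S ->
  modal_decomposition S U lam ->
  0 < eta -> 0 < d -> 0 < gamma ->
  M_mx S = eta%:M ->
  D_mx S = d%:M ->
  (forall i j, edge S i j -> weight S i j = gamma) ->
  (exists! Qx, lyapunov S U lam Qx) /\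
  forall Qx, lyapunov S U lam Qx ->
    let b := fun i => disturbance S 0 i in
    let trB2 := \tr (B_mx S *m B_mx S) in
    [/\ forall i : 'I_p.+1,
          Qomega S U Qx i i =
            ((2 * d * eta)^-1
              - gamma * (p.+1%:R - 1)
                / (d * p.+1%:R * (2 * d ^+ 2 + gamma * eta * p.+1%:R))) * b i ^+ 2
            + gamma / (d * p.+1%:R * (2 * d ^+ 2 + gamma * eta * p.+1%:R))
              * (trB2 - b i ^+ 2),
        Qdelta S U Qx =
          (2 * d * gamma * p.+1%:R)^-1 *:
            ((incidence S)^T *m (B_mx S *m B_mx S) *m incidence S),
        forall (k : 'I_(nlines S)) (i j : 'I_p.+1), line k = (i, j) ->
          Qdelta S U Qx k k =
            (2 * d * gamma * p.+1%:R)^-1 * (b i ^+ 2 + b j ^+ 2)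
      & \tr (Qdelta S U Qx) = (p.+1%:R - 1) / (2 * d * gamma * p.+1%:R) * trB2].
Proof.
move=> _ completeS modalS eta0 d0 gamma0 MS DS wS.
have lyapE := uniform_lyapunovP completeS modalS eta0 d0 gamma0 MS DS wS.
split.
  by eexists; split=> [|Qx /lyapE->//]; apply/lyapE.
move=> Qx /lyapE-> b trB2.
have B2E : B_mx S *m B_mx S = diag_mx (\row_j b j ^+ 2).
  by rewrite /B_mx mulmx_diag; congr diag_mx.
have QE := uniform_Qdelta completeS modalS eta0 d0 gamma0 MS wS.
have Qkk k : Qdelta S U (uniform_covariance S U eta d gamma) k k =
    (2 * d * gamma * p.+1%:R)^-1 * (b (line k).1 ^+ 2 + b (line k).2 ^+ 2).
  by rewrite QE mxE B2E incidence_diag_diag !mxE.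
split=> [i|//|k i j lk|].
- exact: (uniform_Qomega_diag completeS modalS eta0 d0 gamma0 MS wS).
- by rewrite Qkk lk.
(* Summed over the lines, each [b i ^+ 2] occurs once for every line at node [i]. *)
- rewrite /mxtrace (eq_bigr _ (fun k _ => Qkk k)) -mulr_sumr.
  rewrite (sum_complete_lines completeS (fun i => b i ^+ 2)) mulrA
    [_^-1 * _]mulrC.
  congr (_ * _); rewrite /trB2 B2E mxtrace_diag.
  by apply: eq_bigr => i _; rewrite mxE.
Qed.
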